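(* Let $\Omega$, $F$, $K$ be as in the context. Suppose that $\Omega$ is compact, that $F(\Omega):=\bigcup_{x\in\Omega}F(x)$ is bounded, and that $\operatorname{gph}F:=\{(x,y)\in\mathbb{R}^n\times\mathbb{R}^m: y\in F(x)\}$ is closed. Then for every $x\in\Omega$ there exists $\bar x\in\operatorname{cl}\left(\bigcup_{p\in\mathbb{N}}\operatorname{argmin}_x(\mathcal{VP}_p)\right)$ such that $F(\bar x)\preceq^\ell_KF(x)$, i.e. $F(x)\subseteq F(\bar x)+K$.
   Context: $\mathbb{N}=\{1,2,\ldots\}$ and $[p]=\{1,\ldots,p\}$. Setting: $\Omega\subseteq\mathbb{R}^n$ is nonempty and closed; $F:\mathbb{R}^n\rightrightarrows\mathbb{R}^m$ is a set-valued mapping with $\Omega\subseteq \operatorname{dom}F:=\{x: F(x)\neq\emptyset\}$ and $F(x)$ compact for every $x\in\Omega$; $K\subseteq\mathbb{R}^m$ is a closed, convex, pointed ($K\cap(-K)=\{0\}$), solid ($\operatorname{int}K\ne\emptyset$) cone. Multiobjective problem $(\mathcal{VP}_p)$, $p\in\mathbb{N}$: minimize $(y^1,\ldots,y^p)\in\mathbb{R}^{mp}$ with respect to the cone $K^p=\prod_{i=1}^pK$ over all feasible $(x,y^1,\ldots,y^p)$, i.e. $x\in\Omega$ and $y^i\in F(x)$ for all $i\in[p]$. A feasible $(\bar x,\bar y^1,\ldots,\bar y^p)$ is a minimal solution if there is no feasible $(x,y^1,\ldots,y^p)$ with $(\bar y^1-y^1,\ldots,\bar y^p-y^p)\in K^p\setminus\{0\}$.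 The set $\operatorname{argmin}_x(\mathcal{VP}_p)$ is the projection onto the $x$-component in $\mathbb{R}^n$ of the set of minimal solutions of $(\mathcal{VP}_p)$. *)

(* Defs.v *)
From HB Require Import structures.
From mathcomp Require Import all_boot all_order all_algebra.
From mathcomp Require Import all_classical all_reals all_analysis.

Set Implicit Arguments.
Unset Strict Implicit.
Unset Printing Implicit Defensive.

Import Order.TTheory GRing.Theory Num.Theory.
Import numFieldNormedType.Exports.

Local Open Scope classical_set_scope.
Local Open Scope ring_scope.

Section Sets.
Variables (R : realType) (n m : nat).
Implicit Types (K A B : set 'rV[R]_m) (Omega : set 'rV[R]_n).
Implicit Types F : 'rV[R]_n -> set 'rV[R]_m.

Definition cone K := forall (t : R) y, 0 <= t -> K y -> K (t *: y).

Definition pointed_cone K := K `&` [set - y | y in K] = [set 0].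

Definition solid K := interior K !=set0.

Definition set_add A B := [set a + b | a in A & b in B].

Definition lower_le K A B := B `<=` set_add A K.

Definition dom F := [set x | F x !=set0].

Definition gph F := [set xy : 'rV[R]_n * 'rV[R]_m | F xy.1 xy.2].

Definition set_image F Omega := \bigcup_(x in Omega) F x.

End Sets.

(* A family (y^1, ..., y^p) of vectors of R^m is a finite function on 'I_p. *)

Definition cone_pow {R : realType} {m : nat} (K : set 'rV[R]_m) (p : nat) :=
  [set y : {ffun 'I_p -> 'rV[R]_m} | forall i, K (y i)].
Arguments cone_pow {R m} K p _.

Definition feasible {R : realType} {n m : nat} (Omega : set 'rV[R]_n)
    (F : 'rV[R]_n -> set 'rV[R]_m) (p : nat) :=
  [set z : 'rV[R]_n * {ffun 'I_p -> 'rV[R]_m} |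
    Omega z.1 /\ forall i, F z.1 (z.2 i)].
Arguments feasible {R n m} Omega F p _.

Definition minimal_solutions {R : realType} {n m : nat} (Omega : set 'rV[R]_n)
    (F : 'rV[R]_n -> set 'rV[R]_m) (K : set 'rV[R]_m) (p : nat) :=
  [set zbar | feasible Omega F p zbar /\
    ~ exists2 z, feasible Omega F p z &
        (cone_pow K p `\ 0) (zbar.2 - z.2)].
Arguments minimal_solutions {R n m} Omega F K p _.

(* Only meaningful for 0 < p: argmin_x Omega F K 0 is all of Omega. *)
Definition argmin_x {R : realType} {n m : nat} (Omega : set 'rV[R]_n)
    (F : 'rV[R]_n -> set 'rV[R]_m) (K : set 'rV[R]_m) (p : nat) :=
  [set z.1 | z in minimal_solutions Omega F K p].
Arguments argmin_x {R n m} Omega F K p _.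

(* Main.v *)
(* Fix [x]. For finitely many points [y^1, ..., y^p] of [F x], the p-tuple
   problem has a minimal solution dominating [(x, y^1, ..., y^p)], by Zorn's
   lemma and compactness; its x-component [u] satisfies [y^i \in F u + K] for
   every [i]. Hence the sets [{u | y \in F u + K}], [y \in F x], which are
   closed as projections of compact sets, have the finite intersection property
   in the closure of the union of the argmin sets; any point of their
   intersection is the required [xbar]. *)
Require Import Defs.
From HB Require Import structures.
From mathcomp Require Import all_boot all_order all_algebra.
From mathcomp Require Import all_classical all_reals all_analysis.

Set Implicit Arguments.
Unset Strict Implicit.
Unset Printing Implicit Defensive.

Import Order.TTheory GRing.Theory Num.Theory.
Import numFieldNormedType.Exports.

Local Open Scope classical_set_scope.
Local Open Scope ring_scope.

(** Zorn's lemma on the elements of [C] below [x0]: the closed lower sections of a chain have the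
    finite intersection property in [C], so compactness bounds the chain from below. For a mere
    preorder, minimality holds only up to equivalence. *)
Lemma compact_minimal (T : topologicalType) (le : T -> T -> Prop)
    (C : set T) :
  (forall x, le x x) -> (forall y x z, le x y -> le y z -> le x z) ->
  (forall c, closed [set x | le x c]) -> compact C ->
  forall x0, C x0 ->
    exists x, [/\ C x, le x x0 & forall y, C y -> le y x -> le x y].
Proof.
move=> le_refl le_trans le_closed C_compact x0 Cx0.
(* [x0] serves as the distinguished point of the pointed space to which [compact_In0] is applied. *)
pose pT : ptopologicalType := HB.pack T (isPointed.Build T x0).
pose S := {x : T | C x /\ le x x0}.
pose s0 : S := exist _ x0 (conj Cx0 (le_refl x0)).
(* The order is reversed, so that a maximal element is minimal for [le]. *)
have [|||[x [Cx xx0]] x_min] := @ZL_preorder S s0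
    (fun s t => `[< le (sval t) (sval s) >]).
- by move=> t; apply/asboolP.
- move=> r s t /asboolP rs /asboolP st; apply/asboolP.
  exact: le_trans st rs.
- move=> A A_total; have [->|/set0P[a Aa]] := eqVneq A set0.
    by exists s0.
  (* By totality, finitely many elements of the chain have a lower bound inside the chain. *)
  have lower (D' : seq T) : (forall c, c \in D' -> (sval @` A) c) ->
      exists2 z, A z & forall c, c \in D' -> le (sval z) c.
    elim: D' => [_|c D' IH D'A]; first by exists a.
    have [d dD'|z Az zD'] := IH.
      by apply: D'A; rewrite inE dD' orbT.
    have [b Ab bc] : (sval @` A) c by apply: D'A; rewrite mem_head.
    have [/asboolP zb|/asboolP bz] := A_total _ _ Ab Az.
      exists z => // d; rewrite inE => /predU1P[->|/zD'//].
      by rewrite -bc.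
    exists b => // d; rewrite inE => /predU1P[->|/zD' zd].
      by rewrite bc.
    exact: le_trans bz zd.
  have [z zP] : \bigcap_(c in sval @` A) (C `&` [set x | le x c]) !=set0.
    move: (C_compact : @compact pT C); rewrite compact_In0; apply.
      by exists (fun c => [set x | le x c]) => // c _; exact: le_closed.
    move=> D' D'A.
    have [c cD'|z Az zD'] := lower (finmap.enum_fset D').
      by have := D'A c cD'; rewrite inE.
    exists (sval z) => c cD'; split; last exact: zD'.
    by case: (svalP z).
  have [Cz za] := zP _ (imageP sval Aa).
  have zx0 : le z x0 by apply: le_trans za _; case: (svalP a).
  exists (exist _ z (conj Cz zx0)) => s As; apply/asboolP.
  by case: (zP _ (imageP sval As)).
exists x; split=> // y Cy yx.
have yx0 : le y x0 := le_trans _ _ _ yx xx0.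
by move/asboolP: (x_min (exist _ y (conj Cy yx0)) (asboolT yx)).
Qed.

(** [x + y] is the midpoint of [2 *: x] and [2 *: y]. *)
Lemma cone_add (R : realType) (m : nat) (K : set 'rV[R]_m) :
  convex_set K -> cone K -> forall x y, K x -> K y -> K (x + y).
Proof.
move=> K_convex K_cone x y Kx Ky.
have half_ge0 : 0 <= 2^-1 :> R by rewrite invr_ge0.
have half_le1 : 2^-1 <= 1 :> R by rewrite invf_le1 ?ler1n.
have half : 1 - 2^-1 = 2^-1 :> R by rewrite {1}[1]splitr div1r addrK.
have := K_convex (2 *: x) (2 *: y) (Itv01 half_ge0 half_le1).
rewrite !inE /conv /= [unstable.onem _]half !scalerA.
rewrite mulVf ?pnatr_eq0// !scale1r.
by apply; apply: K_cone.
Qed.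

Lemma pointed_cone0 (R : realType) (m : nat) (K : set 'rV[R]_m) :
  pointed_cone K -> K 0.
Proof. by move=> Kp; have [] : (K `&` [set - y | y in K]) 0 by rewrite Kp. Qed.

Section Domination.
Variables (R : realType) (n m : nat).
Variables (Omega : set 'rV[R]_n) (F : 'rV[R]_n -> set 'rV[R]_m).
Variable K : set 'rV[R]_m.
Hypotheses (K_closed : closed K) (K_convex : convex_set K) (K_cone : cone K).
Hypothesis K_pointed : pointed_cone K.
Hypothesis Omega_compact : compact Omega.
Hypothesis FOmega_bounded : bounded_set (set_image F Omega).
Hypothesis F_closed : closed (gph F).

Let B := closure (set_image F Omega).

Let B_compact : compact B.
Proof.
apply: bounded_closed_compact; last exact: closed_closure.
have [M [M_real FM]] := FOmega_bounded.
exists M; split=> // N MN.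
have N_closed : closed [set w : 'rV[R]_m | `|w| <= N].
  rewrite (_ : [set _ | _] = Num.norm @^-1` [set t | t <= N])//.
  apply: preimage_closed; last exact: closed_le.
  by move=> w _; exact: norm_continuous.
suff : B `<=` [set w | `|w| <= N] by [].
rewrite [X in _ `<=` X](closure_id _).1//.
by apply: closure_subset => w; exact: FM.
Qed.

Let sub_B x y : Omega x -> F x y -> B y.
Proof. by move=> Ox Fxy; apply: subset_closure; exists x. Qed.

Lemma lower_closed (T : topologicalType) (f : T -> 'rV[R]_m) (y : 'rV[R]_m) :
  continuous f -> closed [set t | K (y - f t)].
Proof.
move=> f_cont; rewrite (_ : [set _ | _] = (fun t => y - f t) @^-1` K)//.
apply: preimage_closed => // t _.
by apply: continuousB; [exact: cvg_cst|exact: f_cont].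
Qed.

(** Projecting onto [u] eliminates [v]. Projections need not preserve closedness, but confining [v]
    to the compact set [B] makes the projected set compact. *)
Lemma lower_le_closed (y : 'rV[R]_m) :
  closed [set u | Omega u /\ exists2 v, F u v & K (y - v)].
Proof.
rewrite (_ : [set _ | _] =
    fst @` ((Omega `*` B) `&` (gph F `&` [set z | K (y - z.2)]))).
  apply: compact_closed; first exact: norm_hausdorff.
  apply: continuous_compact.
    by apply: continuous_subspaceT => z; exact: cvg_fst.
  apply: compact_closedI; first exact: compact_setX.
  apply: closedI => //; apply: lower_closed => z; exact: cvg_snd.
apply/seteqP; split=> [u [Ou [v Fuv Kyv]]|_ [[u v] /= [[Ou _] [Fuv Kyv]] <-]].
  by exists (u, v) => //; split=> //; split=> //; exact: sub_B Fuv.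
by split=> //; exists v.
Qed.

(** [compact_minimal] is applied to the feasible set with the componentwise preorder of [K]. *)
Lemma domination (p : nat) x (y : 'I_p -> 'rV[R]_m) :
  Omega x -> (forall i, F x (y i)) ->
  exists2 z, minimal_solutions Omega F K p z & forall i, K (y i - z.2 i).
Proof.
move=> Ox Fxy.
(* Families are plain functions here, so that Tychonoff's theorem applies; the minimal point is
   turned into a finite function at the end. *)
pose T : topologicalType :=
  ('rV[R]_n * prod_topology (fun _ : 'I_p => 'rV[R]_m))%type.
pose le (z w : T) := forall i, K (w.2 i - z.2 i).
have proj2_cont i : continuous (fun z : T => z.2 i).
  move=> z.
  apply: (@continuous_comp _ _ _ snd (fun f : prod_topology _ => f i)).
    exact: cvg_snd.
  exact: proj_continuous.
pose C : set T := (Omega `*` [set f | forall i, B (f i)]) `&`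
  [set z | forall i, gph F (z.1, z.2 i)].
have C_compact : compact C.
  apply: compact_closedI.
    apply: compact_setX => //.
    exact: (@tychonoff 'I_p (fun _ => 'rV[R]_m) (fun _ => B)).
  rewrite (_ : [set _ | _] =
      \bigcap_(i in [set: 'I_p]) (fun z : T => (z.1, z.2 i)) @^-1` gph F).
    apply: closed_bigI => i _; apply: preimage_closed => // z _.
    apply: (@cvg_pair _ _ _ _ (nbhs z.1) (nbhs (z.2 i))).
      exact: cvg_fst.
    exact: proj2_cont.
  by apply/seteqP; split=> [z Cz i _|z Cz i]; exact: Cz.
have le_closed c : closed [set z : T | le z c].
  rewrite (_ : [set _ | _] =
      \bigcap_(i in [set: 'I_p]) [set z : T | K (c.2 i - z.2 i)]).
    by apply: closed_bigI => i _; exact: lower_closed.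
  by apply/seteqP; split=> [z Cz i _|z Cz i]; exact: Cz.
have CE (z : T) : C z <-> Omega z.1 /\ forall i, F z.1 (z.2 i).
  split=> [[[]]//|[Oz Fz]]; split=> //; split=> // i; exact: sub_B (Fz i).
have le_refl z : le z z by move=> i; rewrite subrr; exact: pointed_cone0.
have le_trans v u w : le u v -> le v w -> le u w.
  move=> uv vw i; rewrite -(subrKA (v.2 i)).
  exact: (cone_add K_convex K_cone (vw i) (uv i)).
have [z [Cz zy z_min]] := compact_minimal le_refl le_trans le_closed C_compact
  ((CE (x, y)).2 (conj Ox Fxy)).
have [Oz Fz] := (CE z).1 Cz.
exists (z.1, [ffun i => z.2 i]) => [|i] /=; last by rewrite ffunE; exact: zy.
split; first by split=> //= i; rewrite ffunE.
move=> [[u w] [Ou Fw]] /= [Kzw]; apply; apply/ffunP => i /=.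
have wz : le (u, w : _ -> _) z.
  by move=> j; have := Kzw j; rewrite !ffunE.
have zw := z_min (u, w : _ -> _) ((CE (_, _)).2 (conj Ou Fw)) wz.
(* Minimality for the preorder puts both this difference and its opposite in [K]; pointedness makes
   it zero. *)
suff : (K `&` [set - y | y in K]) (z.2 i - w i).
  by rewrite K_pointed !ffunE.
split; first exact: wz.
by exists (w i - z.2 i); [exact: zw|rewrite opprB].
Qed.

End Domination.

Theorem theorem3p9 (R : realType) (n m : nat)
    (Omega : set 'rV[R]_n) (F : 'rV[R]_n -> set 'rV[R]_m)
    (K : set 'rV[R]_m)
    (Omega_nonempty : Omega !=set0) (Omega_closed : closed Omega)
    (Omega_dom : Omega `<=` dom F)
    (F_compact : forall x, Omega x -> compact (F x))
    (K_closed : closed K) (K_convex : convex_set K) (K_cone : cone K)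
    (K_pointed : pointed_cone K) (K_solid : solid K)
    (Omega_compact : compact Omega)
    (FOmega_bounded : bounded_set (set_image F Omega))
    (F_closed : closed (gph F)) :
  forall x, Omega x ->
    exists2 xbar : 'rV[R]_n,
      closure (\bigcup_(p in [set p : nat | (0 < p)%N]) argmin_x Omega F K p)
        xbar
      & lower_le K (F xbar) (F x).
Proof.
move=> x Ox; have [y0 Fy0] := Omega_dom _ Ox.
set A := closure _.
have A_sub : A `<=` Omega.
  rewrite [X in _ `<=` X](closure_id _).1//; apply: closure_subset.
  by move=> _ [p _ [z [[Oz _] _] <-]].
have A_compact : compact A.
  by apply: subclosed_compact Omega_compact A_sub; exact: closed_closure.
pose C y := [set u | Omega u /\ exists2 v, F u v & K (y - v)].
have [xbar xbarP] : \bigcap_(y in F x) (A `&` C y) !=set0.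
  move: A_compact; rewrite compact_In0; apply.
    by exists C => // y _; exact: lower_le_closed.
  move=> D DF; pose s := finmap.enum_fset D.
  (* [s] is padded with [y0] so that [0 < p] even if [D] is empty. *)
  have Fs (i : 'I_(size s).+1) : F x (nth y0 s i).
    have [/(mem_nth y0)/DF|?] := ltnP i (size s); first by rewrite inE.
    by rewrite nth_default.
  have [z z_min sz] := domination K_closed K_convex K_cone K_pointed
    Omega_compact FOmega_bounded F_closed Ox Fs.
  (* One point serves all [y] in [D]: [z.1] lies in the argmin set for [p = (size s).+1], and the
     component of [z] at [index y s] dominates [y]. *)
  exists z.1 => y ys; split.
    by apply: subset_closure; exists (size s).+1 => //; exists z.
  have [[Oz Fz] _] := z_min; split=> //.
  have ys' : (index y s < (size s).+1)%N by rewrite ltnS index_size.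
  exists (z.2 (Ordinal ys')); first exact: Fz.
  by have := sz (Ordinal ys'); rewrite /= nth_index.
(* Membership in [A] is read off at [y0], since an intersection over an empty [F x] would say
   nothing. *)
exists xbar; first by have [] := xbarP _ Fy0.
move=> y /xbarP[_ [_ [v Fv Kv]]]; exists v => //; exists (y - v) => //.
by rewrite addrC subrK.
Qed.
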